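(* There is an absolute constant $C$ such that every $n$-vertex graph $G$ of pathwidth $k$ has an $xy^+$-monotone EPG-representation in a grid of height at most $8k+C$ and width at most $Cn$; in particular, in a grid of area $O(kn)$.
   Context: A grid of width $w$ and height $h$ consists of the grid-points with integer coordinates in a $w\times h$ box and all grid-edges joining grid-points at distance $1$. An EPG-representation of a graph $G$ assigns to each vertex $v$ a path $\mathrm{path}(v)$ in the grid such that $(v,w)$ is an edge of $G$ if and only if $\mathrm{path}(v)$ and $\mathrm{path}(w)$ share a grid-edge. A grid path is $xy$-monotone if every vertical line and every horizontal line meeting it meets it in a single interval; it is $xy^+$-monotone if it is $xy$-monotone and its left endpoint is not above its right endpoint. An $xy^+$-monotone EPG-representation is one in which all vertex-paths are $xy^+$-monotone. The pathwidth of $G$ is the smallest $k$ such that $G$ is a subgraph of a $(k+1)$-colourable interval graph. *)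

(* Defs.v *)
From mathcomp Require Import all_boot.
Set Implicit Arguments. Unset Strict Implicit. Unset Printing Implicit Defensive.

Definition simple_graph (T : finType) (e : rel T) : Prop :=
  symmetric e /\ irreflexive e.

(* G = (T,e) is a (spanning) subgraph of a (k+1)-colourable interval graph:
   each vertex v gets an interval [l v, r v]; the interval graph joins distinct
   vertices with intersecting intervals; c is a proper (k+1)-colouring of that
   interval graph; every edge of G is an edge of the interval graph. *)
Definition intervals_meet (a b c d : nat) : bool := (a <= d) && (c <= b).

Definition sub_colourable_interval (T : finType) (e : rel T) (k : nat) : Prop :=
  exists (l r : T -> nat) (c : T -> 'I_k.+1),
    (forall v, l v <= r v) /\
    (forall u v, e u v -> intervals_meet (l u) (r u) (l v) (r v)) /\
    (forall u v, u != v -> intervals_meet (l u) (r u) (l v) (r v) -> c u != c v).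

Definition is_pathwidth (T : finType) (e : rel T) (k : nat) : Prop :=
  sub_colourable_interval e k /\
  (forall j, sub_colourable_interval e j -> k <= j).

Definition point := (nat * nat)%type.

Definition grid_adj (p q : point) : bool :=
  (p.1 - q.1) + (q.1 - p.1) + (p.2 - q.2) + (q.2 - p.2) == 1.

Definition grid_path (w h : nat) (s : seq point) : bool :=
  [&& 1 < size s, uniq s,
      all (fun p : point => (p.1 <= w) && (p.2 <= h)) s
    & sorted grid_adj s].

Definition path_edges (s : seq point) : seq (point * point) := zip s (behead s).

Definition same_edge (a b : point * point) : bool :=
  ((a.1 == b.1) && (a.2 == b.2)) || ((a.1 == b.2) && (a.2 == b.1)).

Definition share_edge (s t : seq point) : bool :=
  has (fun a => has (same_edge a) (path_edges t)) (path_edges s).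

(* The path s = p_0 ... p_m (as a curve) is decomposed into features indexed by
   j < 2m+1: feature 2i is the vertex p_i, feature 2i+1 the closed edge p_i p_{i+1}.
   For a coordinate f (fst or snd) and c2 : nat, [line_meets f s c2 j] says
   feature j meets the line {f = c2/2}. *)
Definition line_meets (f : point -> nat) (s : seq point) (c2 j : nat) : bool :=
  (j < (size s).*2.-1) &&
  (if odd j then
     let a := f (nth (0,0) s j./2) in
     let b := f (nth (0,0) s j./2.+1) in
     ((minn a b).*2 <= c2) && (c2 <= (maxn a b).*2)
   else (f (nth (0,0) s j./2)).*2 == c2).

Definition contiguous (P : nat -> bool) : Prop :=
  forall i j m, i <= m -> m <= j -> P i -> P j -> P m.

(* xy-monotone: every vertical and every horizontal line meets the path in a
   single interval (i.e. the set of features met is contiguous).  Lines at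
   coordinates outside (1/2)Z meet only interiors of edges crossing the nearest
   half-integer line, so considering c2/2, c2 : nat, suffices; lines at negative
   coordinates do not meet the path. *)
Definition xy_monotone (s : seq point) : Prop :=
  forall c2 : nat, contiguous (line_meets fst s c2) /\ contiguous (line_meets snd s c2).

Definition xy_plus_monotone (s : seq point) : Prop :=
  xy_monotone s /\
  (let a := head (0,0) s in let b := last (0,0) s in
   (a.1 < b.1 -> a.2 <= b.2) /\ (b.1 < a.1 -> b.2 <= a.2)).

Definition epg_rep (T : finType) (e : rel T) (w h : nat) (P : T -> seq point) : Prop :=
  (forall v, grid_path w h (P v)) /\
  (forall u v, u != v -> (e u v <-> share_edge (P u) (P v))).

Definition xy_plus_epg_rep (T : finType) (e : rel T) (w h : nat) (P : T -> seq point) : Prop :=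
  epg_rep e w h P /\ (forall v, xy_plus_monotone (P v)).

(* Main.v *)
Require Import Defs.
From mathcomp Require Import all_boot.
From mathcomp Require Import zify.
From Stdlib Require Import Classical_Prop.
Set Implicit Arguments. Unset Strict Implicit. Unset Printing Implicit Defensive.

(* The proof rests on a colouring of the vertices by tracks: each vertex meets
   at most one vertex of every track not above its own.  To obtain it, take a
   cover of the union of all intervals by as few intervals as possible: by
   minimality, no interval meets two members of the cover whose ranks (by left
   endpoint) agree modulo 3, so three tracks suffice for the cover.  Removing
   the cover lowers the clique number, so k + 1 rounds use 3 (k + 1) tracks.

   Let M be a middle row.  A vertex v on track q has a low row M - q and a high
   row M + q.  Its path waits in the low row, climbs at the time L v of its left
   endpoint to the high row, and stays there until its right endpoint R v.  While
   climbing it crosses the rows of all vertices on lower tracks, and it follows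
   the row of such a vertex along one edge exactly when the two are adjacent.  So
   that u is already waiting when a neighbour v of u on a higher track climbs, u
   enters its low row at the smallest L w over all w on higher tracks meeting u;
   by the choice of the colouring, these extended intervals are disjoint within
   each track.

   Paths climb along diagonals, so that different climbs stay apart: a climb
   moves right by 4 per block of 4 rows.  The fourth row of each block carries no
   track and absorbs the moves not spent on neighbours.  This makes
   2 * 4 (k + 1) rows, and 4 columns per unit of time. *)

(** * Colouring intervals by tracks *)

Section Colouring.
Variables (T : finType) (L R : T -> nat).
Hypothesis LR : forall v, L v <= R v.

Definition meets (u v : T) := intervals_meet (L u) (R u) (L v) (R v).

Definition covers (S U : {set T}) : Prop :=
  {in S, forall v x, L v <= x <= R v -> exists2 u, u \in U & L u <= x <= R u}.

Lemma minimum_cover (S : {set T}) : exists U : {set T},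
  [/\ U \subset S, covers S U
    & forall U' : {set T}, U' \subset S -> covers S U' -> #|U| <= #|U'|].
Proof.
pose P n := exists U : {set T}, [/\ U \subset S, covers S U & #|U| = n].
have exP : exists n, P n.
  by exists #|S|, S; split=> // v vS x xv; exists v.
have [n [[U [US cU cardU]] minU]] : exists n, P n /\ forall m, P m -> n <= m.
  case: exP => n; elim/ltn_ind: n => n IH Pn.
  have [[m [lt_mn Pm]]|noP] := classic (exists m, m < n /\ P m).
    exact: IH lt_mn Pm.
  exists n; split=> // m Pm; rewrite leqNgt; apply/negP => lt_mn.
  by apply: noP; exists m.
exists U; split=> // U' U'S cU'; rewrite cardU; apply: minU.
by exists U'.
Qed.

(** Members of a minimum cover are not nested, so their left endpoints differ and this is the
    position from left to right. *)
Definition rank (U : {set T}) (u : T) := #|[set a in U | L a < L u]|.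

(** An exchange argument: two distinct members of congruent ranks have at least two members between
    them, and replacing those two by [w] would give a smaller cover. *)
Lemma minimum_cover_meets (S U : {set T}) (w u v : T) :
  U \subset S -> covers S U ->
  (forall U' : {set T}, U' \subset S -> covers S U' -> #|U| <= #|U'|) ->
  w \in S -> u \in U -> v \in U -> meets w u -> meets w v ->
  rank U u = rank U v %[mod 3] -> u = v.
Proof.
move=> US cU minU wS.
have not_nested a b : a \in U -> b \in U -> L a <= L b -> R b <= R a -> a = b.
  move=> aU bU Lab Rba; apply/eqP/negP => /negP neq_ab.
  have cD : covers S (U :\ b).
    move=> z zS x /(cU z zS x) [y yU xy].
    have [eq_yb|neq_yb] := eqVneq y b; last by exists y; rewrite // !inE neq_yb.
    by exists a; [rewrite !inE neq_ab | move: xy Lab Rba; rewrite eq_yb; clear; lia].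
  have := minU _ (subset_trans (subsetDl _ _) US) cD.
  by rewrite (cardsD1 b U) bU ltnn.
wlog Luv : u v / L u <= L v.
  move=> H uU vU wu wv eqr; have [/H|/ltnW/H] := leqP (L u) (L v); first exact.
  by move=> /(_ vU uU wv wu (esym eqr)).
move=> uU vU wu wv eqr; apply/eqP/negP => /negP neq_uv.
have {}Luv : L u < L v.
  rewrite ltn_neqAle Luv andbT; apply/eqP => eqL.
  have [Rle|/ltnW Rle] := leqP (R u) (R v).
    case/eqP: neq_uv; apply/esym.
    by apply: (not_nested _ _ vU uU); rewrite ?eqL.
  case/eqP: neq_uv.
  by apply: (not_nested _ _ uU vU); rewrite ?eqL.
pose B := [set a in U | L u <= L a < L v].
have rankE : rank U v = rank U u + #|B|.
  rewrite /rank /B -cardsUI.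
  have -> : [set a in U | L a < L u] :&: [set a in U | L u <= L a < L v] = set0.
    by apply/setP => a; rewrite !inE; case: (a \in U); clear; lia.
  rewrite cards0 addn0; congr #|pred_of_set _|.
  by apply/setP => a; rewrite !inE; case: (a \in U) => //=; move: Luv; clear; lia.
have uB : u \in B by rewrite !inE uU leqnn Luv.
(* The size of [B] is a multiple of 3, and positive because [u] is in [B]; hence two further members
   remain. *)
have B3 : 2 < #|B|.
  have : 0 < #|B| by rewrite (cardsD1 u) uB.
  by move: eqr; rewrite rankE; move: #|B| (rank U u) => b r; clear; lia.
have /card_gt1P [a [b [aB bB neq_ab]]] : 1 < #|B :\ u|.
  by move: B3; rewrite (cardsD1 u B) uB.
move: aB bB; rewrite !inE => /and4P [neq_au aU ua av] /and4P [neq_bu bU ub bv].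
(* Only a point between u and v can be covered by a or b alone, and w covers it. *)
pose U' := w |: (U :\ a :\ b).
have U'S : U' \subset S.
  apply/subsetP => x; rewrite !inE => /orP [/eqP -> //|/and3P [_ _]].
  exact: (subsetP US).
have neq_av : a != v by apply: contraTneq av => ->; rewrite ltnn.
have neq_bv : b != v by apply: contraTneq bv => ->; rewrite ltnn.
have cU' : covers S U'.
  move=> z zS x /(cU z zS x) [y yU xy].
  have [yab|] := boolP ((y == a) || (y == b)); last first.
    by rewrite negb_or => /andP [ya yb]; exists y; rewrite // !inE yb ya yU orbT.
  have Ry : R y < R v.
    rewrite ltnNge; apply/negP => Rvy.
    case/orP: yab => /eqP ey; move: Rvy; rewrite ey => Rvy.
      by have := not_nested _ _ aU vU (ltnW av) Rvy => /eqP; apply/negP.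
    by have := not_nested _ _ bU vU (ltnW bv) Rvy => /eqP; apply/negP.
  have Ly : L u <= L y by case/orP: yab => /eqP ->.
  have [xu|ux] := leqP x (R u).
    exists u; last by move: xy Ly xu; clear; lia.
    by rewrite !inE uU [u == a]eq_sym [u == b]eq_sym neq_au neq_bu orbT.
  have [vx|xv] := leqP (L v) x.
    exists v; last by move: xy Ry vx; clear; lia.
    by rewrite !inE vU [v == a]eq_sym [v == b]eq_sym neq_av neq_bv orbT.
  exists w; first by rewrite !inE eqxx.
  by move: wu wv ux xv; rewrite /meets /intervals_meet; clear; lia.
have := minU _ U'S cU'.
rewrite (cardsD1 a U) aU (cardsD1 b (U :\ a)) !inE eq_sym neq_ab bU /U'.
have := leq_card_setU [set w] (U :\ a :\ b).
rewrite cards1 => [[]]; move: #|_| #|_| => m p; clear; lia.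
Qed.

Lemma colouring_in (K : nat) (S : {set T}) :
  (forall x, #|[set v in S | L v <= x <= R v]| <= K) ->
  exists q : T -> nat,
    [/\ {in S, forall v, q v < 4 * K}, forall v, q v %% 4 != 0
      & {in S & &, forall u v w, q u = q v -> q u <= q w ->
           meets w u -> meets w v -> u = v}].
Proof.
elim: K S => [|K IH] S thin.
  have noS v : v \notin S.
    apply/negP => vS; have := thin (L v).
    by rewrite leqn0 cards_eq0 => /eqP/setP/(_ v); rewrite !inE vS leqnn LR.
  by exists (fun=> 1); split=> // v; rewrite (negPf (noS v)).
have [U [US cU minU]] := minimum_cover S.
have [|q [qK q4 qP]] := IH (S :\: U).
  (* Removing [U] lowers the depth at every point: wherever [S] has an interval, so has [U]. *)
  move=> x; have [[y yU xy]|no] :=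
    classic (exists2 u, u \in U & L u <= x <= R u).
    have := thin x; rewrite (cardsD1 y) !inE (subsetP US _ yU) xy /=.
    rewrite add1n ltnS; apply: leq_trans; apply/subset_leq_card/subsetP => z.
    rewrite !inE => /andP [/andP [zU ->] ->]; rewrite !andbT.
    by apply: contraNneq zU => ->.
  suff -> : [set v in S :\: U | L v <= x <= R v] = set0 by rewrite cards0.
  apply/setP => v; rewrite !inE; apply/negP => /andP [/andP [_ vS] xv].
  exact: no (cU v vS x xv).
(* The cover takes the lowest tracks 1, 2, 3, since its uniqueness holds against every [w] in [S].
   For [u], [v] outside [U], a [w] on a track not below theirs is also outside [U], as the induction
   hypothesis requires. *)
exists (fun v => if v \in U then (rank U v %% 3).+1 else 4 + q v); split.
- move=> v vS; case: ifP => vU; first by lia.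
  by have := qK v; rewrite !inE vU vS => /(_ isT); lia.
- by move=> v; case: ifP => _; [lia | have := q4 v; lia].
move=> u v w uS vS wS.
have [uU|uU] := boolP (u \in U); have [vU|vU] := boolP (v \in U).
- move=> [eqr] _ wu wv.
  exact: (minimum_cover_meets US cU minU wS uU vU wu wv eqr).
- by move: (_ %% 3) (ltn_pmod (rank U u) (isT : 0 < 3)) (q v); clear; lia.
- by move: (_ %% 3) (ltn_pmod (rank U v) (isT : 0 < 3)) (q u); clear; lia.
have [wU|wU] := boolP (w \in U).
  have u0 : 0 < q u by case: (q u) (q4 u).
  by move: (_ %% 3) (ltn_pmod (rank U w) (isT : 0 < 3)) u0 (q v); clear; lia.
move=> /addnI equv; rewrite leq_add2l => leuw.
by apply: qP equv leuw; rewrite !inE ?uU ?vU ?wU.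
Qed.

End Colouring.

(** * Staircase paths *)

(** Feature [j], vertex or edge, spans the values of [f] from position [j./2] to position
    [uphalf j], and both bounds are nondecreasing in [j]. *)
Lemma contiguous_line_meets (f : point -> nat) (s : seq point) (c2 : nat) :
  (forall i j, i <= j < size s -> f (nth (0, 0) s i) <= f (nth (0, 0) s j)) ->
  contiguous (line_meets f s c2).
Proof.
move=> mono.
pose lo j := f (nth (0, 0) s j./2); pose hi j := f (nth (0, 0) s (uphalf j)).
have meetsE j : line_meets f s c2 j =
    [&& j < (size s).*2.-1, (lo j).*2 <= c2 & c2 <= (hi j).*2].
  rewrite /line_meets /lo /hi uphalf_half; case: ltnP => //= lt_j.
  case: (boolP (odd j)) => oj /=; last by rewrite add0n eqn_leq.
  have := mono j./2 j./2.+1; rewrite add1n leqnSn /= => le_f.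
  have {}le_f := le_f ltac:(by lia).
  by rewrite (minn_idPl le_f) (maxn_idPr le_f).
move=> i j m le_im le_mj; rewrite !meetsE.
move=> /and3P [_ _ hi_i] /and3P [lt_j lo_j _]; apply/and3P; split.
- exact: leq_ltn_trans lt_j.
- apply: leq_trans lo_j; rewrite leq_double; apply: mono; rewrite half_leq //=.
  by move: lt_j; clear; lia.
- apply: (leq_trans hi_i); rewrite leq_double; apply: mono; rewrite uphalf_leq //=.
  by move: lt_j le_mj; clear; rewrite uphalf_half; lia.
Qed.

Section Staircase.

Definition stair_step (f : nat -> nat) (p : point) : point :=
  if p.1 < f p.2.+1 then (p.1.+1, p.2) else (p.1, p.2.+1).

(* In row y the path spans the columns f y, ..., f y.+1. *)
Definition stair (f : nat -> nat) (y0 y1 : nat) : seq point :=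
  traject (stair_step f) (f y0, y0) (f y1.+1 - f y0 + (y1 - y0)).+1.

Variables (f : nat -> nat) (y0 y1 : nat).
Hypothesis f_homo : {homo f : y z / y <= z}.
Hypothesis lt_y01 : y0 < y1.

Let node i := iter i (stair_step f) (f y0, y0).

Lemma stair_node i :
  [/\ f (node i).2 <= (node i).1 <= f (node i).2.+1, y0 <= (node i).2
    & (node i).1 + (node i).2 = f y0 + y0 + i].
Proof.
elim: i => [|i] /=; first by rewrite leqnn f_homo ?addn0.
rewrite /stair_step; case: (node i) => x y /= [/andP [lo hi] le_y sum].
case: ltnP => [lt_x|ge_x] /=; first by rewrite lt_x (leqW lo) addSn sum addnS.
by rewrite ge_x (leq_trans hi) ?f_homo // (leqW le_y) addnS sum addnS.
Qed.

(** The coordinate sum grows by one per step, which gives the index. A node with the same sum in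
    another row would be weakly displaced the same way in its column, contradicting equal sums. *)
Lemma node_reach x y :
  y0 <= y -> f y <= x <= f y.+1 -> node (x + y - (f y0 + y0)) = (x, y).
Proof.
move=> le_y /andP [lo hi].
have := stair_node (x + y - (f y0 + y0)).
case: (node _) => x' y' /= [/andP [lo' hi'] le_y'].
have := f_homo le_y.
rewrite subnKC; last by rewrite leq_add // (leq_trans (f_homo le_y)).
have [lt_y|lt_y|->] := ltngtP y y'; last by move=> _ /addIn ->.
  by have := f_homo lt_y; move: lt_y lo hi lo' hi'; clear; lia.
by have := f_homo lt_y; move: lt_y lo hi lo' hi'; clear; lia.
Qed.

Lemma node_row i :
  i <= f y1.+1 - f y0 + (y1 - y0) ->
  (node i).2 <= y1 /\ (i < f y1.+1 - f y0 + (y1 - y0) ->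
    (node i).1 < f (node i).2.+1 \/ (node i).2 < y1).
Proof.
have := stair_node i; case: (node i) => x y /= [/andP [lo hi] le_y sum] le_i.
have le_f := f_homo (leqW (ltnW lt_y01)).
have le_y1 : y <= y1.
  rewrite leqNgt; apply/negP => lt_y; have := f_homo lt_y.
  by move: le_i sum lo lt_y le_f lt_y01; clear; lia.
split=> // lt_i; have [|ge_y] := ltnP y y1; [by right | left].
have ey : y = y1 by apply/eqP; rewrite eqn_leq le_y1.
by move: lt_i sum le_f lt_y01; rewrite ey; clear; lia.
Qed.

Lemma path_edges_traject (g : point -> point) p n :
  path_edges (traject g p n.+1) = [seq (a, g a) | a <- traject g p n].
Proof. by elim: n p => [|n IH] p //=; have := IH (g p); rewrite /path_edges /= => ->. Qed.

(** The final disjunction excludes just the endpoint [(f y1.+1, y1)], from which no edge leaves. *)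
Lemma mem_path_edges_stair a :
  a \in path_edges (stair f y0 y1) <->
  exists x y, [/\ a = ((x, y), stair_step f (x, y)), y0 <= y <= y1,
                  f y <= x <= f y.+1 & x < f y.+1 \/ y < y1].
Proof.
rewrite path_edges_traject; split.
  case/mapP => p /trajectP [i lt_i ->] ->.
  have [le1 /(_ lt_i) short] := node_row (ltnW lt_i).
  have [] := stair_node i; rewrite -/(node i).
  case: (node i) short le1 => x y /= short le1 in_row ge0 _.
  by exists x, y; rewrite ge0.
case=> x [y [-> /andP [ge0 le1] /[dup] /andP [lo hi] in_row short]].
apply/mapP; exists (x, y) => //; apply/trajectP.
exists (x + y - (f y0 + y0)); last by rewrite -/(node _) node_reach.
have := f_homo ge0; have := f_homo le1; have := f_homo (leqnSn y1).
have : f y.+1 <= f y1.+1 by apply: f_homo.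
case: short => [lt_x|lt_y]; last have := f_homo lt_y.
  by move: lo hi ge0 le1 lt_x; clear; lia.
by move: lo hi ge0 le1 lt_y; clear; lia.
Qed.

Lemma stair_grid_path w h :
  f y1.+1 <= w -> y1 <= h -> grid_path w h (stair f y0 y1).
Proof.
move=> le_w le_h; apply/and4P; split.
- by rewrite size_traject; move: lt_y01; clear; lia.
- rewrite /stair looping_uniq; apply/negP => /trajectP [i lt_i].
  have := stair_node i; have := stair_node (f y1.+1 - f y0 + (y1 - y0)).
  rewrite /node => -[_ _ sum1] [_ _ sum2] eq_i; move: sum1 sum2 lt_i; rewrite eq_i.
  by move=> -> /addnI ->; rewrite ltnn.
- apply/allP => p /trajectP [i]; rewrite ltnS => lt_i ->; rewrite -/(node i).
  have [le1 _] := node_row lt_i; have [/andP [_ hi] _ _] := stair_node i.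
  by rewrite (leq_trans hi) ?(leq_trans le1) // (leq_trans _ le_w) // f_homo.
- rewrite /stair /=; apply: sub_path (fpath_traject _ _ _) => p q /eqP <-.
  by rewrite /grid_adj /stair_step; case: ifP => _ /=; clear; lia.
Qed.

Lemma stair_xy_plus_monotone : xy_plus_monotone (stair f y0 y1).
Proof.
have homo_node (c : point -> nat) : (forall p, c p <= c (stair_step f p)) ->
    {homo (fun i => c (node i)) : i j / i <= j}.
  by move=> le_c; apply: homo_leq => [n|n m p|i]; [|exact: leq_trans|exact: le_c].
have le1 p : p.1 <= (stair_step f p).1 by rewrite /stair_step; case: ifP.
have le2 p : p.2 <= (stair_step f p).2 by rewrite /stair_step; case: ifP.
split.
  move=> c2; split; apply: contiguous_line_meets => i j;
    rewrite /stair size_traject => /andP [le_ij lt_j];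
    rewrite !(set_nth_default (f y0, y0) (0, 0)) ?size_traject ?(leq_ltn_trans le_ij) //;
    rewrite !nth_traject ?(leq_ltn_trans le_ij) //.
    exact: (homo_node fst).
  exact: (homo_node snd).
rewrite /stair /= last_traject.
have := homo_node _ le1 _ _ (leq0n (f y1.+1 - f y0 + (y1 - y0))).
have := homo_node _ le2 _ _ (leq0n (f y1.+1 - f y0 + (y1 - y0))).
by rewrite /node /= => h2 h1; split=> // lt1; move: (leq_trans lt1 h1); rewrite ltnn.
Qed.

End Staircase.

(** The first alternative is a common horizontal edge in row [y]; the second is a common vertical
    edge, since a staircase leaves row [y] in column [f y.+1]. *)
Lemma share_edge_stair (f g : nat -> nat) (y0 y1 z0 z1 : nat) :
  {homo f : y z / y <= z} -> {homo g : y z / y <= z} -> y0 < y1 -> z0 < z1 ->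
  share_edge (stair f y0 y1) (stair g z0 z1) <->
  (exists x y, [/\ y0 <= y <= y1, z0 <= y <= z1, f y <= x < f y.+1 & g y <= x < g y.+1])
  \/ (exists y, [/\ y0 <= y < y1, z0 <= y < z1 & f y.+1 = g y.+1]).
Proof.
move=> f_homo g_homo lt_y lt_z; split.
  case/hasP => a /(mem_path_edges_stair f_homo lt_y) [x [y [-> yb fx short]]].
  case/hasP => b /(mem_path_edges_stair g_homo lt_z) [x' [y' [-> yb' gx short']]].
  rewrite /same_edge /= => /orP [/andP [/eqP [ex ey] /eqP]|/andP [/eqP e1 /eqP e2]].
    subst x' y'; rewrite /stair_step /=; case: ltnP => hf; case: ltnP => hg //.
    - move=> _; left; exists x, y; rewrite yb yb' hf hg.
      by case/andP: fx => ->; case/andP: gx => ->.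
    - by case=> /eqP; rewrite eqn_leq ltnn.
    - by case=> /eqP; rewrite eqn_leq ltnn andbF.
    move=> _; right; exists y; split.
    - by case/andP: yb => -> _; case: short => //; rewrite ltnNge hf.
    - by case/andP: yb' => -> _; case: short' => //; rewrite ltnNge hg.
    by move: fx gx hf hg; clear; lia.
  (* Every step increases the coordinate sum, so no edge is traversed in opposite directions. *)
  have step_sum (h : nat -> nat) (p : point) :
      (stair_step h p).1 + (stair_step h p).2 = (p.1 + p.2).+1.
    by rewrite /stair_step; case: ifP => _ /=; rewrite ?addSn ?addnS.
  have := step_sum f (x, y); have := step_sum g (x', y').
  by rewrite -e1 e2 /=; clear; lia.
case=> [[x [y [yb zb /andP [fx xf] /andP [gx xg]]]]|[y [/andP [y0y yy1] /andP [z0y yz1] e]]].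
  apply/hasP; exists ((x, y), stair_step f (x, y)).
    apply/(mem_path_edges_stair f_homo lt_y); exists x, y; split=> //; last by left.
    by rewrite fx ltnW.
  apply/hasP; exists ((x, y), stair_step g (x, y)).
    apply/(mem_path_edges_stair g_homo lt_z); exists x, y; split=> //; last by left.
    by rewrite gx ltnW.
  by rewrite /same_edge /stair_step /= xf xg !eqxx.
apply/hasP; exists ((f y.+1, y), stair_step f (f y.+1, y)).
  apply/(mem_path_edges_stair f_homo lt_y); exists (f y.+1), y; split=> //.
  - by rewrite y0y ltnW.
  - by rewrite leqnn f_homo.
  by right.
apply/hasP; exists ((f y.+1, y), stair_step g (f y.+1, y)).
  apply/(mem_path_edges_stair g_homo lt_z); exists (f y.+1), y; split=> //.
  - by rewrite z0y ltnW.
  - by rewrite e leqnn g_homo.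
  by right.
by rewrite /same_edge /stair_step /= e ltnn !eqxx.
Qed.

(** * The representation *)

Section Representation.
Variables (T : finType) (e : rel T) (L R : T -> nat) (K : nat) (q : T -> nat).
Hypothesis e_sym : symmetric e.
Hypothesis L_inj : injective L.
Hypothesis LR : forall v, L v <= R v.
Hypothesis e_meets : forall u v, e u v -> meets L R u v.
Hypothesis q_lt : forall v, q v < 4 * K.
Hypothesis q_mod : forall v, q v %% 4 != 0.
Hypothesis q_unique : forall u v w, q u = q v -> q u <= q w ->
  meets L R w u -> meets L R w v -> u = v.

(** Admitting the track of [v] makes [v] itself a candidate, so the minimum exists and is at most
    [L v]; no other vertex of that track meets [v]. *)
Definition start (v : T) : nat :=
  L [arg min_(w < v | meets L R w v && (q v <= q w)) L w].

Lemma meets_refl v : meets L R v v.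
Proof. by rewrite /meets /intervals_meet LR. Qed.

Lemma startP v : exists2 w, meets L R w v /\ q v <= q w & start v = L w.
Proof.
rewrite /start; case: arg_minnP => [|w /andP [wv qw] _]; last by exists w.
by rewrite meets_refl leqnn.
Qed.

Lemma start_le v w : meets L R w v -> q v <= q w -> start v <= L w.
Proof.
move=> wv qw; rewrite /start; case: arg_minnP => [|z _]; last by apply; rewrite wv.
by rewrite meets_refl leqnn.
Qed.

Lemma start_le_L v : start v <= L v.
Proof. by rewrite start_le ?meets_refl. Qed.

(** If [L u <= L v], the vertex [w] attaining [start v] begins by time [t], hence by [R u], and
    lasts until [L v]. So it meets both [u] and [v], and [q_unique] applies. *)
Lemma extended_disjoint u v t :
  q u = q v -> start u <= t <= R u -> start v <= t <= R v -> u = v.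
Proof.
wlog le_uv : u v / L u <= L v.
  move=> H quv ut vt; have [/H|/ltnW/H] := leqP (L u) (L v); first exact.
  by move=> /(_ (esym quv) vt ut).
move=> quv /andP [_ tu] /andP [sv _].
have [w [wv qw] sE] := startP v.
apply: (@q_unique u v w) => //; first by rewrite quv.
rewrite sE in sv; move: wv; rewrite /meets /intervals_meet => /andP [_ vw].
by rewrite (leq_trans sv tu) (leq_trans le_uv vw).
Qed.

(** Rows at a distance from [M] divisible by 4 carry no track; this choice gives them residue 3, the
    last row of a block, on both sides of [M]. *)
Let M := 4 * K - 1.

(** The truncated differences add up to the distance of [z] from [M], so [z] is the low or high row
    of a neighbour present when [w] climbs. *)
Definition neighbour_row (w : T) (z : nat) : bool :=
  [exists v, [&& e w v, q v == (z - M) + (M - z), start v <= L w & L w <= R v]].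

Definition base (t y : nat) := 4 * t + 4 * (y %/ 4).

(** The sum counts the horizontal edges already spent in the current block. It is at most 3 and
    restarts with each block, where [base] has advanced by 4. *)
Definition diag (w : T) (y : nat) : nat :=
  base (L w) y + \sum_(4 * (y %/ 4) <= z < y) neighbour_row w z.

(** The column in which the path enters row [y]. The last value ends the path just past the four
    columns of time [R v]; the constant extensions keep the function monotone on all rows. *)
Definition column (v : T) (y : nat) : nat :=
  if y <= M - q v then base (start v) (M - q v)
  else if y <= M + q v then diag v y
  else base (R v) (M + q v) + 4.

Definition route (v : T) : seq point := stair (column v) (M - q v) (M + q v).

Lemma q_gt0 v : 0 < q v.
Proof. by case: (q v) (q_mod v). Qed.

Lemma q_le v : q v <= M.
Proof. by have := q_lt v; rewrite /M; clear; lia. Qed.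

Lemma low_lt_high v : M - q v < M + q v.
Proof. by move: (q_gt0 v); clear; lia. Qed.

Lemma low_mod v : (M - q v) %% 4 != 3.
Proof. by move: (q_mod v) (q_lt v); rewrite /M; clear; lia. Qed.

Lemma high_mod v : (M + q v) %% 4 != 3.
Proof. by move: (q_mod v) (q_lt v); rewrite /M; clear; lia. Qed.

Lemma diag_ge w y : base (L w) y <= diag w y.
Proof. exact: leq_addr. Qed.

Lemma diag_le w y : diag w y <= base (L w) y + y %% 4.
Proof.
rewrite leq_add2l.
have : \sum_(4 * (y %/ 4) <= z < y) neighbour_row w z
       <= \sum_(4 * (y %/ 4) <= z < y) 1.
  by apply: leq_sum => z _; apply: leq_b1.
by move/leq_trans; apply; rewrite sum_nat_const_nat muln1; clear; lia.
Qed.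

Lemma diagS w y : y %% 4 != 3 -> diag w y.+1 = diag w y + neighbour_row w y.
Proof.
move=> y3; rewrite /diag /base.
have -> : y.+1 %/ 4 = y %/ 4 by move: y3; clear; lia.
by rewrite big_nat_recr ?addnA //=; clear; lia.
Qed.

Lemma diag_leS w y : diag w y <= diag w y.+1.
Proof.
have [y3|/diagS ->] := eqVneq (y %% 4) 3; last exact: leq_addr.
apply: leq_trans (diag_le w y) (leq_trans _ (diag_ge w y.+1)).
by rewrite /base; move: y3; clear; lia.
Qed.

Lemma column_low v : column v (M - q v) = base (start v) (M - q v).
Proof. by rewrite /column leqnn. Qed.

Lemma column_mid v y : M - q v < y <= M + q v -> column v y = diag v y.
Proof. by rewrite /column ltnNge => /andP [/negPf -> ->]. Qed.

Lemma column_end v : column v (M + q v).+1 = base (R v) (M + q v) + 4.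
Proof.
by rewrite /column ltnn leqNgt ltnS (leq_trans (leq_subr _ _) (leq_addr _ _)).
Qed.

Lemma column_homo v : {homo column v : y z / y <= z}.
Proof.
apply: homo_leq => [n|m n p|y]; [by []|exact: leq_trans|].
have [lt_y|ge_y] := ltnP y (M - q v); first by rewrite /column lt_y (ltnW lt_y).
have [gt_y|le_y] := ltnP (M + q v) y.
  have lt_y := ltn_trans (low_lt_high v) gt_y.
  by rewrite /column (leqNgt y (M - q v)) (leqNgt y.+1 (M - q v)) (leqNgt y (M + q v))
             (leqNgt y.+1 (M + q v)) gt_y lt_y (leqW gt_y) (leqW lt_y).
have [->|ne_y] := eqVneq y (M + q v).
  rewrite column_end column_mid ?low_lt_high ?leqnn //.
  apply: leq_trans (diag_le _ _) _.
  by move: (LR v); rewrite /base; move: (L v) (R v); clear; lia.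
have {ne_y}lt_y : y < M + q v by rewrite ltn_neqAle ne_y.
rewrite [X in _ <= X]column_mid ?ltnS ?ge_y //.
have [->|ne_y] := eqVneq y (M - q v).
  rewrite column_low; apply: leq_trans (diag_ge _ _).
  rewrite /base leq_add // leq_mul2l ?start_le_L //=; exact: leq_div2r.
by rewrite column_mid ?diag_leS // le_y andbT ltn_neqAle eq_sym ne_y.
Qed.

(* In row z the columns 4t + 4(z/4), ..., 4t + 4(z/4) + 3 belong to time t. *)
Lemma column_time v z x :
  M - q v <= z <= M + q v -> column v z <= x < column v z.+1 ->
  start v <= x %/ 4 - z %/ 4 <= R v /\
  (M - q v < z < M + q v -> x %/ 4 - z %/ 4 = L v).
Proof.
move=> /andP [lo hi].
have sL := start_le_L v; have LRv := LR v.
have [->|ne_lo] := eqVneq z (M - q v).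
  rewrite ltnn column_low column_mid ?leqnn ?low_lt_high // => /andP [x1 x2].
  (* The low row is not the last of its block, so the path leaves it within the columns of time
     [L v]. *)
  split=> //; move: x1 (leq_trans x2 (diag_le _ _)) (low_mod v) sL LRv.
  by rewrite /base; clear; lia.
have lt_lo : M - q v < z by rewrite ltn_neqAle eq_sym ne_lo.
have [->|ne_hi] := eqVneq z (M + q v).
  rewrite ltnn andbF column_end column_mid ?leqnn ?low_lt_high // => /andP [x1 x2].
  split=> //; move: (leq_trans (diag_ge _ _) x1) x2 sL LRv.
  by rewrite /base; clear; lia.
have lt_hi : z < M + q v by rewrite ltn_neqAle ne_hi.
rewrite !column_mid ?lt_lo ?lt_hi ?ltnS ?lo //= => /andP [x1 x2].
have -> : x %/ 4 - z %/ 4 = L v.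
  move: (leq_trans (diag_ge _ _) x1) (leq_trans x2 (diag_le _ _)).
  by rewrite /base; clear; lia.
by rewrite sL LRv.
Qed.

(** In row [z] each path either waits or climbs. Two waiting paths would share track and time, two
    climbing ones would share [L]. If [b] climbs past a waiting [a], its horizontal edge reveals a
    neighbour on the track of [a] present at [L b], which must be [a]. *)
Lemma shared_row u v z x :
  u != v ->
  M - q u <= z <= M + q u -> M - q v <= z <= M + q v ->
  column u z <= x < column u z.+1 -> column v z <= x < column v z.+1 ->
  e u v.
Proof.
have end_or_mid w : M - q w <= z <= M + q w ->
    q w = (z - M) + (M - z) \/ M - q w < z < M + q w.
  move=> /andP [lo hi]; have [mid|not_mid] := boolP (M - q w < z < M + q w).
    by right.
  by left; move: lo hi (q_le w) not_mid; clear; lia.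
have end_mid a b : M - q a <= z <= M + q a -> q a = (z - M) + (M - z) ->
    M - q b < z < M + q b ->
    column a z <= x < column a z.+1 -> column b z <= x < column b z.+1 -> e b a.
  move=> az qa bz ax bx.
  have [ta _] := column_time az ax.
  have [|_ /(_ bz) tb] := column_time _ bx.
    by case/andP: bz => /ltnW -> /ltnW ->.
  have z3 : z %% 4 != 3.
    by move: qa (q_lt a) (q_mod a); rewrite /M; clear; lia.
  have [lo hi] := andP bz.
  move: bx; rewrite !column_mid ?hi ?lo ?ltnS ?(ltnW lo) ?(ltnW hi) //.
  rewrite diagS //; case: (boolP (neighbour_row b z)) => [|_]; last first.
    by rewrite addn0 => /andP [x1 /(leq_ltn_trans x1)]; rewrite ltnn.
  case/existsP => c /and4P [bc /eqP qc s1 s2] _.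
  rewrite tb in ta.
  by rewrite (@extended_disjoint a c (L b)) ?s1 ?qa ?qc.
move=> neq_uv uz vz ux vx.
have [qu|um] := end_or_mid _ uz; have [qv|vm] := end_or_mid _ vz.
- have [tu _] := column_time uz ux; have [tv _] := column_time vz vx.
  by case/eqP: neq_uv; apply: extended_disjoint tu tv; rewrite qu qv.
- by rewrite e_sym; apply: end_mid ux vx.
- exact: end_mid vx ux.
have [_ /(_ um) tu] := column_time uz ux; have [_ /(_ vm) tv] := column_time vz vx.
by case/eqP: neq_uv; apply: L_inj; rewrite -tu tv.
Qed.

(** At time [L v] the vertex [u] is in its low row if [L v < L u] and in its high row if
    [L u < L v]. The climb of [v] takes a horizontal edge in both, starting at the witness
    [diag v]. *)
Lemma edge_share_row u v :
  e u v -> q u < q v -> exists x y,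
    [/\ M - q u <= y <= M + q u, M - q v <= y <= M + q v,
        column u y <= x < column u y.+1 & column v y <= x < column v y.+1].
Proof.
move=> euv lt_q.
have vu : meets L R v u by apply: e_meets; rewrite e_sym.
have sv : start u <= L v by apply: start_le (ltnW lt_q).
have vR : L v <= R u by case/andP: vu.
have qle := q_le v.
have neq : L u != L v by apply: contraTneq lt_q => /L_inj ->; rewrite ltnn.
have step z : q u = (z - M) + (M - z) -> z %% 4 != 3 ->
    diag v z <= diag v z < diag v z.+1.
  move=> qz z3; rewrite leqnn diagS //= -addn1 leq_add2l lt0b.
  by apply/existsP; exists u; rewrite e_sym euv qz eqxx sv.
have [lt_L|le_L] := ltnP (L v) (L u).
  exists (diag v (M - q u)), (M - q u).
  rewrite leqnn (ltnW (low_lt_high u)); split=> //.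
  - by move: lt_q qle; clear; lia.
  - rewrite column_low column_mid ?leqnn ?low_lt_high //.
    have := diag_ge u (M - q u).+1; have := diag_le v (M - q u).
    have := diag_ge v (M - q u); have := low_mod u; move: sv lt_L.
    by rewrite /base; clear; lia.
  rewrite !column_mid ?step ?low_mod //; move: (q_le u) lt_q qle; clear; lia.
have {}lt_L : L u < L v by rewrite ltn_neqAle neq.
exists (diag v (M + q u)), (M + q u).
rewrite leqnn (ltnW (low_lt_high u)); split=> //.
- by move: lt_q qle; clear; lia.
- rewrite column_end column_mid ?leqnn ?low_lt_high //.
  have := diag_le u (M + q u); have := diag_le v (M + q u).
  have := diag_ge v (M + q u); have := high_mod u; move: vR lt_L.
  by rewrite /base; clear; lia.
rewrite !column_mid ?step ?high_mod //; move: (q_le u) lt_q qle; clear; lia.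
Qed.

Lemma route_representation w h :
  (forall v, 4 * R v + 8 * K + 4 <= w) -> 8 * K <= h -> xy_plus_epg_rep e w h route.
Proof.
move=> Rw Kh; split; last first.
  by move=> v; apply: stair_xy_plus_monotone.
split=> [v|u v neq_uv].
  apply: stair_grid_path; [exact: column_homo | exact: low_lt_high | |].
    rewrite column_end /base; move: (Rw v) (q_lt v); rewrite /M; clear; lia.
  by move: (q_lt v) Kh; rewrite /M; clear; lia.
have shareP := share_edge_stair (column_homo u) (column_homo v)
                 (low_lt_high u) (low_lt_high v).
split=> [euv|/shareP].
  apply/shareP; left.
  have [lt_q|lt_q|eq_q] := ltngtP (q u) (q v).
  - exact: edge_share_row.
  - have [|x [y [a b c d]]] := edge_share_row _ lt_q; first by rewrite e_sym.
    by exists x, y.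
  case/eqP: neq_uv; apply: (@q_unique u v u) => //; first exact: meets_refl.
  exact: e_meets.
case=> [[x [y [uy vy ux vx]]]|[y [uy vy eqc]]]; first exact: shared_row ux vx.
(* At a common vertical edge both paths climb; equal columns in row [y.+1] then force equal
   times. *)
case/eqP: neq_uv; apply: L_inj.
move: eqc; rewrite !column_mid => [eqc||].
- have := diag_ge u y.+1; have := diag_le u y.+1.
  have := diag_ge v y.+1; have := diag_le v y.+1.
  by rewrite eqc /base; clear; lia.
- by case/andP: vy => lo hi; rewrite ltnS lo.
by case/andP: uy => lo hi; rewrite ltnS lo.
Qed.

End Representation.

(** * Bounding times and pathwidth by the number of vertices *)

(** Each left endpoint is replaced by its rank, ties broken by [enum_rank], and each right endpoint
    by the rank of the last left endpoint not after it. The predecessor appears because ranks start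
    at 0. *)
Lemma compress_intervals (T : finType) (l r : T -> nat) :
  (forall v, l v <= r v) ->
  exists L R : T -> nat,
    [/\ injective L, forall v, R v < #|T| & forall u v, (L u <= R v) = (l u <= r v)].
Proof.
move=> lr.
pose key v := l v * #|T| + enum_rank v.
have key_lt u v : l u < l v -> key u < key v.
  move=> lt_l; rewrite /key; apply: (@leq_trans ((l u).+1 * #|T|)).
    by rewrite mulSn addnC ltn_add2r.
  by apply: leq_trans (leq_addr _ _); rewrite leq_mul2r lt_l orbT.
have key_inj : injective key.
  move=> u v eq_key; have [lt_l|lt_l|eq_l] := ltngtP (l u) (l v).
  - by have := key_lt _ _ lt_l; rewrite eq_key ltnn.
  - by have := key_lt _ _ lt_l; rewrite eq_key ltnn.
  by move: eq_key; rewrite /key eq_l => /addnI /val_inj /enum_rank_inj.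
pose before v := [set u | key u < key v].
pose upto v := [set u | l u <= r v].
have upto_gt0 v : 0 < #|upto v| by apply/card_gt0P; exists v; rewrite inE.
exists (fun v => #|before v|), (fun v => #|upto v|.-1); split=> [|v|u v].
- have mono u v : key u < key v -> #|before u| < #|before v|.
    move=> lt_uv; apply/proper_card/properP; split.
      by apply/subsetP => w; rewrite !inE => /ltn_trans; apply.
    by exists u; rewrite !inE ?ltnn.
  move=> u v eq_card; apply: key_inj.
  by have [/mono|/mono|//] := ltngtP (key u) (key v); rewrite eq_card ltnn.
- by rewrite prednK // max_card.
rewrite -ltnS prednK //.
have [le_uv|lt_vu] := leqP (l u) (r v).
  apply/proper_card/properP; split; last by exists u; rewrite !inE ?ltnn.
  apply/subsetP => w; rewrite !inE => lt_key; apply: leq_trans le_uv.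
  by rewrite leqNgt; apply: contraL lt_key => /key_lt /ltnW; rewrite -leqNgt.
apply/negbTE; rewrite -leqNgt; apply/subset_leq_card/subsetP => w.
by rewrite !inE => le_w; apply/key_lt/(leq_ltn_trans le_w).
Qed.

(** Equal intervals with pairwise distinct colours give a colouring with [#|T|] colours. *)
Lemma pathwidth_lt_card (T : finType) (e : rel T) (k : nat) :
  0 < #|T| -> is_pathwidth e k -> k < #|T|.
Proof.
move=> T_gt0 [_ minimal]; rewrite -(prednK T_gt0) ltnS; apply: minimal.
exists (fun=> 0), (fun=> 0), (fun v => cast_ord (esym (prednK T_gt0)) (enum_rank v)).
split=> //; split=> // u v neq_uv _; apply: contra neq_uv => /eqP.
by move=> /cast_ord_inj /enum_rank_inj ->.
Qed.

Theorem theorem9 :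
  exists C : nat,
    forall (T : finType) (e : rel T) (k : nat),
      simple_graph e -> is_pathwidth e k ->
      exists (w h : nat) (P : T -> seq point),
        [/\ h <= 8 * k + C, w <= C * #|T| & xy_plus_epg_rep e w h P].
Proof.
(* Since [R v < #|T|] and [k < #|T|], the width [4 * R v + 8 * k.+1 + 4] is at most [12 * #|T|]; the
   height [8 * k.+1] needs only 8. *)
exists 12 => T e k [e_sym _] pw.
have [T0|T_gt0] := posnP #|T|.
  exists 0, 0, (fun=> [::]); split=> //.
  have noT (v : T) : False by move: (fintype0 v); rewrite T0.
  by split; [split=> v | move=> v]; case: (noT v).
have k_lt := pathwidth_lt_card T_gt0 pw.
case: pw => [[l [r [c [lr [e_lr c_proper]]]]] _].
have [L [R [L_inj R_lt LRE]]] := compress_intervals lr.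
have meetsE u v : meets L R u v = intervals_meet (l u) (r u) (l v) (r v).
  by rewrite /meets /intervals_meet !LRE.
have LR v : L v <= R v by rewrite LRE.
(* Intervals through a common point meet pairwise, so [c] is injective on them. *)
have thin x : #|[set v in [set: T] | L v <= x <= R v]| <= k.+1.
  rewrite -[k.+1]card_ord -(card_in_imset (f := c)) ?max_card // => u v.
  rewrite !inE /= => /andP [u1 u2] /andP [v1 v2] eq_c; apply/eqP.
  apply: contraTT isT => neq_uv; have := c_proper _ _ neq_uv.
  rewrite -meetsE /meets /intervals_meet (leq_trans u1 v2) (leq_trans v1 u2).
  by rewrite eq_c eqxx => /(_ isT).
have [q [q_lt q_mod q_unique]] := colouring_in LR thin.
exists (12 * #|T|), (8 * k.+1), (route e L R k.+1 q); split=> //.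
  by rewrite mulnS addnC leq_add2l.
apply: route_representation => //.
- by move=> u v /e_lr; rewrite meetsE.
- by move=> v; apply: q_lt.
- by move=> u v w; apply: q_unique.
move=> v; move: (R_lt v) k_lt; clear; lia.
Qed.
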